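(* Let $(\mathfrak{X}, \Gamma, \Phi)$ and $(\mathfrak{X}', \Gamma', \Phi')$ be minimal equicontinuous Cantor actions which are continuously orbit equivalent. If $(\mathfrak{X}, \Gamma, \Phi)$ is renormalizable and locally quasi-analytic, then $(\mathfrak{X}', \Gamma', \Phi')$ is virtually renormalizable.
   Context: A Cantor action $(\mathfrak{X},\Gamma,\Phi)$ is a minimal action $\Phi\colon\Gamma\times\mathfrak{X}\to\mathfrak{X}$ by homeomorphisms of a finitely generated group $\Gamma$ on a Cantor metric space $\mathfrak{X}$. A set $U\subset\mathfrak{X}$ is adapted to the action if it is non-empty, clopen, and $\Phi(\gamma)(U)\cap U\neq\emptyset$ implies $\Phi(\gamma)(U)=U$ for all $\gamma\in\Gamma$. For $U$ adapted, $\Gamma_U=\{\gamma\in\Gamma\mid\Phi(\gamma)(U)=U\}$, $H_U\subset\mathrm{Homeo}(U)$ is the image of $\Gamma_U$ under restriction to $U$, and $(U,H_U,\Phi_U)$ is the resulting action of $H_U$ on $U$. A Cantor action $(\mathfrak{X},\Gamma,\Phi)$ is renormalizable if it is equicontinuous and there exist an adapted proper clopen subset $U\subset\mathfrak{X}$, a homeomorphism $\lambda\colon\mathfrak{X}\to U$ and a group isomorphism $\Theta\colon\Gamma\to H_U$ such that $\Phi(\gamma)=\lambda^{-1}\circ\Phi_U(\Theta(\gamma))\circ\lambda$ for all $\gamma\in\Gamma$, and $\bigcap_{\ell\ge0}\lambda^\ell(\mathfrak{X})$ is a point. It is virtually renormalizable if it is equicontinuous and there exists an adapted set $V\subset\mathfrak{X}$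 such that $(V,H_V,\Phi_V)$ is renormalizable. An action $\Phi\colon H\times\mathfrak{X}\to\mathfrak{X}$ is locally quasi-analytic if there is $\varepsilon>0$ such that for any non-empty open $U$ with $\mathrm{diam}(U)<\varepsilon$ and any non-empty open $V\subset U$, if $g\in H$ satisfies $\Phi(g)(V)=V$ and $\Phi(g)|V=\mathrm{id}_V$, then $\Phi(g)$ is the identity on $U$. A continuous orbit equivalence between $(\mathfrak{X},\Gamma,\Phi)$ and $(\mathfrak{X}',\Gamma',\Phi')$ is a homeomorphism $h\colon\mathfrak{X}\to\mathfrak{X}'$ which maps the orbit equivalence relation $\{(x,\gamma x)\}$ of $\Phi$ onto that of $\Phi'$ (and similarly for $h^{-1}$), together with continuous functions $\alpha\colon\Gamma\times\mathfrak{X}\to\Gamma'$ and $\beta\colon\Gamma'\times\mathfrak{X}'\to\Gamma$ (groups discrete) such that: (1) for each $x\in\mathfrak{X}$ and $\gamma\in\Gamma$ there is an open set $U_x\ni x$ with $\Phi'(\alpha(\gamma,x))\circ h|U_x=h\circ\Phi(\gamma)|U_x$; (2) for each $y\in\mathfrak{X}'$ and $\gamma'\in\Gamma'$ there is an open set $V_y\ni y$ with $\Phi(\beta(\gamma',y))\circ h^{-1}|V_y=h^{-1}\circ\Phi'(\gamma')|V_y$. The maps $\alpha,\beta$ are not assumed to be cocycles. *)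

(* Defs.v *)
From HB Require Import structures.
From mathcomp Require Import all_boot all_order all_algebra.
From mathcomp Require Import all_classical all_reals all_analysis.

Set Implicit Arguments.
Unset Strict Implicit.
Unset Printing Implicit Defensive.

Local Open Scope group_scope.
Local Open Scope classical_set_scope.

Definition inverse_homeos (S T : topologicalType) (f : S -> T) (g : T -> S) :=
  [/\ cancel f g, cancel g f, continuous f & continuous g].

Definition homeomorphism (S T : topologicalType) (f : S -> T) :=
  exists g : T -> S, inverse_homeos f g.

(* Homeo(X), a group under composition: (f * g) x = f (g x). *)
Record homeo (X : topologicalType) := Homeo {
  homeo_fun :> X -> X;
  _ : `[< homeomorphism homeo_fun >] }.

HB.instance Definition _ (X : topologicalType) :=
  [isSub for @homeo_fun X].
HB.instance Definition _ (X : topologicalType) := [Choice of homeo X by <:].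

Section HomeoGroup.
Variable X : topologicalType.
Implicit Types f g h : homeo X.

Lemma homeoP f : homeomorphism f.
Proof. by case: f => f /= /asboolP. Qed.

Lemma homeo_eqP f g : f =1 g -> f = g.
Proof. by move=> fg; apply/val_inj/funext. Qed.

Lemma homeo_one_subproof : `[< homeomorphism (@id X) >].
Proof. by apply/asboolP; exists id; split => // x; exact: cvg_id. Qed.

Lemma homeo_mul_subproof f g : `[< homeomorphism (f \o g) >].
Proof.
apply/asboolP; have [f' [fK f'K fc f'c]] := homeoP f.
have [g' [gK g'K gc g'c]] := homeoP g.
exists (g' \o f'); split.
- exact: can_comp.
- exact: can_comp.
- by move=> x; apply: continuous_comp; [exact: gc|exact: fc].
- by move=> x; apply: continuous_comp; [exact: f'c|exact: g'c].
Qed.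

Definition homeo_inv_fun f : X -> X := sval (cid (homeoP f)).

Lemma homeo_inv_funP f : inverse_homeos f (homeo_inv_fun f).
Proof. by rewrite /homeo_inv_fun; case: cid. Qed.

Lemma homeo_inv_subproof f : `[< homeomorphism (homeo_inv_fun f) >].
Proof. by apply/asboolP; exists f; case: (homeo_inv_funP f). Qed.

Definition homeo_one := Homeo homeo_one_subproof.
Definition homeo_mul f g := Homeo (homeo_mul_subproof f g).
Definition homeo_inv f := Homeo (homeo_inv_subproof f).

Lemma homeo_mulA : associative homeo_mul.
Proof. by move=> f g h; exact: homeo_eqP. Qed.

Lemma homeo_mul1 : left_id homeo_one homeo_mul.
Proof. by move=> f; exact: homeo_eqP. Qed.

Lemma homeo_1mul : right_id homeo_one homeo_mul.
Proof. by move=> f; exact: homeo_eqP. Qed.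

Lemma homeo_mulVf : left_inverse homeo_one homeo_inv homeo_mul.
Proof. by move=> f; apply: homeo_eqP; case: (homeo_inv_funP f). Qed.

Lemma homeo_mulfV : right_inverse homeo_one homeo_inv homeo_mul.
Proof. by move=> f; apply: homeo_eqP; case: (homeo_inv_funP f). Qed.

HB.instance Definition _ := isGroup.Build (homeo X)
  homeo_mulA homeo_mul1 homeo_1mul homeo_mulVf homeo_mulfV.

End HomeoGroup.

Record homeo_action (G : groupType) (X : topologicalType) := HomeoAction {
  hact :> G -> X -> X;
  hact1 : forall x, hact 1 x = x;
  hactM : forall g h x, hact (g * h) x = hact g (hact h x);
  hact_continuous : forall g, continuous (hact g) }.

Section Restriction.
Variables (G : groupType) (X : topologicalType).
Variables (Phi : homeo_action G X) (U : set X).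

Lemma hactK g : cancel (Phi g) (Phi g^-1).
Proof. by move=> x; rewrite -hactM mulVg hact1. Qed.

Lemma hactKV g : cancel (Phi g^-1) (Phi g).
Proof. by move=> x; rewrite -hactM mulgV hact1. Qed.

Lemma hact_homeomorphism g : homeomorphism (Phi g).
Proof.
exists (Phi g^-1); split; [exact: hactK|exact: hactKV| |];
  exact: hact_continuous.
Qed.

Definition stabilizer : set G := [set g | Phi g @` U = U].

Lemma stabilizer1 : stabilizer 1.
Proof.
apply/seteqP; split => [_ [x Ux <-]|x Ux]; first by rewrite hact1.
by exists x; rewrite ?hact1.
Qed.

Lemma stabilizerM g h : stabilizer g -> stabilizer h -> stabilizer (g * h).
Proof.
move=> gU hU; apply/seteqP; split => [_ [x Ux <-]|x Ux].
  by rewrite -gU hactM; exists (Phi h x) => //; rewrite -hU; exists x.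
move: Ux; rewrite -{1}gU => -[y + <-]; rewrite -{1}hU => -[z Uz <-].
by exists z; rewrite ?hactM.
Qed.

Lemma stabilizerV g : stabilizer g -> stabilizer g^-1.
Proof.
move=> gU; apply/seteqP; split => [_ [x + <-]|x Ux].
  by rewrite -{1}gU => -[y Uy <-]; rewrite hactK.
by exists (Phi g x); rewrite ?hactK// -gU; exists x.
Qed.

(* [f : homeo U] belongs to H_U: it is the restriction of some Phi g with
   g in the stabilizer of U. *)
Definition restr_pred : pred (homeo U) :=
  fun f => `[< exists2 g, stabilizer g &
                 forall x : U, set_val (f x) = Phi g (set_val x) >].

Lemma restr_group_closed : group_closed restr_pred.
Proof.
split; first by apply/asboolP; exists 1 => [|x];
  [exact: stabilizer1|rewrite hact1].
move=> f h /asboolP[g gU gf] /asboolP[k kU kh]; apply/asboolP.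
exists (g * k^-1); first exact/stabilizerM/stabilizerV.
move=> x; rewrite hactM gf; congr (Phi g _).
have hK : h ((h^-1)%g x) = x.
  by have := mulgV h => /(congr1 (fun u : homeo U => u x)).
by rewrite -[in RHS]hK kh hactK.
Qed.

Record restr_group := RestrGroup {
  restr_homeo :> homeo U;
  _ : restr_pred restr_homeo }.

HB.instance Definition _ := [isSub for restr_homeo].
HB.instance Definition _ := [Choice of restr_group by <:].
HB.instance Definition _ :=
  SubChoice_isSubGroup.Build (homeo U) restr_pred restr_group
    restr_group_closed.

Lemma restr_act1 (x : U) : (1 : restr_group) x = x.
Proof. by []. Qed.

Lemma restr_actM (g h : restr_group) (x : U) :
  (g * h : restr_group) x = g (h x).
Proof. by []. Qed.

Lemma restr_act_continuous (g : restr_group) : continuous g.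
Proof. by have [f []] := homeoP g. Qed.

Definition restr_action : homeo_action restr_group U :=
  @HomeoAction restr_group U (fun g x => g x)
    restr_act1 restr_actM restr_act_continuous.

End Restriction.

Section SubMetric.
Variables (R : realType) (X : metricType R) (U : set X).

Let dist (x y : U) : R := mdist (set_val x) (set_val y).

Let dist_ge0 x y : (0 <= dist x y)%R.
Proof. exact: mdist_ge0. Qed.

Let dist_positivity x y : dist x y = 0%R -> x = y.
Proof. by move=> /mdist_positivity; exact: val_inj. Qed.

Let ballEdist (x : U) d : ball x d = [set y | (dist x y < d)%R].
Proof. by rewrite -initial_ballE ballEmdist. Qed.

HB.instance Definition _ := @PseudoMetric_isMetric.Build R (set_type U)
  dist dist_ge0 dist_positivity ballEdist.

End SubMetric.

Lemma mdist_set_val (R : realType) (X : metricType R) (U : set X) (x y : U) :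
  mdist x y = mdist (set_val x) (set_val y).
Proof. by []. Qed.

Definition diam (R : realType) (X : metricType R) (A : set X) : \bar R :=
  ereal_sup [set (mdist p.1 p.2)%:E | p in A `*` A].

Definition finitely_generated (G : groupType) :=
  exists s : seq G, forall S : {pred G},
    group_closed S -> {subset s <= S} -> forall g, g \in S.

Section Actions.
Variables (R : realType) (G : groupType) (X : metricType R).
Implicit Types (Phi : homeo_action G X) (U V : set X).

Definition minimal Phi := forall x : X, dense (range (fun g => Phi g x)).

(* [cantor_like] alone allows the empty space. *)
Definition cantor_action Phi :=
  [/\ [set: X] !=set0, cantor_like X, finitely_generated G & minimal Phi].

Definition equicontinuous_action Phi :=
  forall e : R, (0 < e)%R -> exists2 d : R, (0 < d)%R &
    forall (g : G) (x y : X),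
      (mdist x y < d)%R -> (mdist (Phi g x) (Phi g y) < e)%R.

Definition adapted Phi U :=
  [/\ U !=set0, clopen U &
      forall g, (Phi g @` U) `&` U !=set0 -> Phi g @` U = U].

Definition locally_quasi_analytic Phi :=
  exists2 e : R, (0 < e)%R &
    forall U V, open U -> U !=set0 -> (diam U < e%:E)%E ->
      open V -> V !=set0 -> V `<=` U ->
      forall g, Phi g @` V = V -> {in V, Phi g =1 id} ->
        {in U, Phi g =1 id}.

Definition renormalizable Phi :=
  [/\ cantor_action Phi, equicontinuous_action Phi &
    exists U, [/\ adapted Phi U, U <> [set: X] &
      exists (lam : X -> U) (lam' : U -> X) (Theta : G -> restr_group Phi U),
        [/\ inverse_homeos lam lam',
            {morph Theta : g h / g * h} /\ bijective Theta,
            forall g, Phi g = lam' \o restr_action Phi U (Theta g) \o lam &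
            exists x : X,
              \bigcap_(l in [set: nat]) range (iter l (set_val \o lam))
              = [set x]]]].

End Actions.

Definition virtually_renormalizable (R : realType) (G : groupType)
    (X : metricType R) (Phi : homeo_action G X) :=
  [/\ cantor_action Phi, equicontinuous_action Phi &
    exists2 V : set X, adapted Phi V & renormalizable (restr_action Phi V)].

Definition orbit_rel (G : groupType) (X : topologicalType)
    (Phi : homeo_action G X) : set (X * X) :=
  [set p | exists g, p.2 = Phi g p.1].

Definition continuously_orbit_equivalent (G G' : groupType)
    (X X' : topologicalType)
    (Phi : homeo_action G X) (Phi' : homeo_action G' X') :=
  exists (h : X -> X') (h' : X' -> X)
    (alpha : discrete_topology G * X -> discrete_topology G')
    (beta : discrete_topology G' * X' -> discrete_topology G),
    [/\ inverse_homeos h h',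
        (fun p => (h p.1, h p.2)) @` orbit_rel Phi = orbit_rel Phi' /\
        (fun p => (h' p.1, h' p.2)) @` orbit_rel Phi' = orbit_rel Phi,
        continuous alpha /\ continuous beta,
        forall (x : X) (g : G), exists U : set X, [/\ open U, U x &
          {in U, Phi' (alpha (g, x)) \o h =1 h \o Phi g}] &
        forall (y : X') (g' : G'), exists V : set X', [/\ open V, V y &
          {in V, Phi (beta (g', y)) \o h' =1 h' \o Phi' g'}]].

(* Main.v *)
Require Import Defs.
From mathcomp Require Import all_boot all_order all_algebra.
From mathcomp Require Import all_classical all_reals all_analysis.
From mathcomp Require Import lra.

(** Why the theorem is true.  An adapted embedding of one action into another
is an open embedding [k] that identifies its source, group included, with the
restriction of the target action to the range of [k], which is an adapted set.
Such maps compose, and a renormalization of a faithful action is the same thing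
as an adapted self-embedding [l] that is not onto and whose iterated ranges
meet in a point [x0] (lemma [renormalizableE]).  It therefore suffices to
find an adapted embedding [k] of [Phi] into [Phi']: the action of [G'] on
[V = range k] is then conjugate to [Phi] by [k], and renormalizability is
invariant under conjugacy ([renormalizable_conj]).  The map used is
[k = h \o iter n l], for [h] the orbit equivalence and [n] large.

Two facts make this [k] adapted.

First, [Phi] is topologically free
([locally_quasi_analytic_topologically_free]).  A renormalization copies the
whole action, at arbitrarily small scale, near [x0].  If an element acts
trivially on some open set, then so does its copy inside a range of diameter
below the constant of local quasi-analyticity; the copy is then trivial on that
whole range, and the original element is trivial on [X].

Second, near [h x0] the orbit equivalence is a conjugacy with a change of group
elements that depends on the element only
([orbit_equivalence_local_conjugacy]).  By topological freeness, the value
[beta (g', y)] is determined by the germ of [Phi' g'] at [y], so [beta] is a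
cocycle although it is not assumed to be one.  By compactness its values on
finitely many generators of [G'] are locally constant at a uniform scale; by
equicontinuity of [Phi'], orbits of close enough points stay within that scale,
and the cocycle identity makes [beta (g', -)] constant on one ball around
[h x0], for all [g'] at once.  Once the [n]-th range of [l] is mapped into this
ball by [h], the map [h \o iter n l] inherits adaptedness from [iter n l]. *)

Set Implicit Arguments.
Unset Strict Implicit.
Unset Printing Implicit Defensive.

Import Order.TTheory GRing.Theory Num.Theory.
Local Open Scope group_scope.
Local Open Scope classical_set_scope.

(** * Adapted embeddings *)

Definition faithful (G : groupType) (X : topologicalType)
    (Phi : homeo_action G X) :=
  forall g g', Phi g =1 Phi g' -> g = g'.

(** For compact [X], the last two clauses make the range of [k] an adapted set
whose stabilizer acts on it exactly as [G] acts on [X].  They compare group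
elements only through what they do on that range: no homomorphism between the
groups is part of the data, and none has to be built to compose two adapted
embeddings.  The isomorphism is recovered once, for faithful actions, in
[adapted_embedding_isom]. *)
Definition adapted_embedding (G K : groupType) (X Y : topologicalType)
    (Phi : homeo_action G X) (Psi : homeo_action K Y) (k : X -> Y) :=
  [/\ injective k, continuous k, forall A, open A -> open (k @` A),
      forall g, exists g', Psi g' \o k =1 k \o Phi g &
      forall g' x y, Psi g' (k x) = k y ->
        exists g, Psi g' \o k =1 k \o Phi g].

Section AdaptedEmbedding.
Variables (G K : groupType) (X Y : topologicalType).
Variables (Phi : homeo_action G X) (Psi : homeo_action K Y).
Implicit Types k : X -> Y.

Lemma adapted_embedding_comp (L : groupType) (Z : topologicalType)
    (Xi : homeo_action L Z) k (j : Y -> Z) :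
  adapted_embedding Psi Xi j -> adapted_embedding Phi Psi k ->
  adapted_embedding Phi Xi (j \o k).
Proof.
move=> [ji jc jo ja jb] [ki kc ko ka kb]; split.
- exact: inj_comp.
- by move=> x; apply: continuous_comp; [exact: kc|exact: jc].
- by move=> A oA; rewrite -image_comp; exact/jo/ko.
- move=> g; have [g1 g1E] := ka g; have [g2 g2E] := ja g1.
  by exists g2 => x /=; rewrite [LHS]g2E /= [Psi _ _]g1E.
- move=> g x y /= gxy; have [g1 g1E] := jb _ _ _ gxy.
  have /kb[g2 g2E] : Psi g1 (k x) = k y.
    by apply: ji; rewrite -gxy; exact/esym/g1E.
  by exists g2 => z /=; rewrite [LHS]g1E /= [Psi _ _]g2E.
Qed.

Lemma adapted_embedding_inv k (k' : Y -> X) (x0 : X) :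
  adapted_embedding Phi Psi k -> cancel k k' -> cancel k' k ->
  adapted_embedding Psi Phi k'.
Proof.
move=> [ki kc ko ka kb] kK k'K.
have k'a g : exists g', Phi g' \o k' =1 k' \o Psi g.
  have /kb[g' g'E] : Psi g (k x0) = k (k' (Psi g (k x0))) by rewrite k'K.
  by exists g' => y /=; rewrite -{2}[y]k'K [Psi _ _]g'E /= kK.
split => //.
- exact: can_inj k'K.
- apply/continuousP => A oA.
  suff -> : k' @^-1` A = k @` A by exact: ko.
  apply/seteqP; split => [y /= Ay|_ [x Ax <-] /=]; last by rewrite kK.
  by exists (k' y).
- move=> A oA.
  suff -> : k' @` A = k @^-1` A by move/continuousP : kc; apply.
  apply/seteqP; split => [_ [y Ay <-] /=|x /= Ax]; first by rewrite k'K.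
  by exists (k x).
- move=> g _ _ _; have [g' g'E] := ka g.
  by exists g' => y /=; rewrite -{2}[y]k'K [Psi _ _]g'E /= kK.
Qed.

(** For faithful actions the group elements that correspond under a conjugacy
determine each other, so any choice of them is an isomorphism of groups. *)
Lemma adapted_embedding_isom k (k' : Y -> X) (x0 : X) :
  faithful Phi -> faithful Psi ->
  adapted_embedding Phi Psi k -> cancel k k' -> cancel k' k ->
  exists Theta : G -> K,
    [/\ {morph Theta : g h / g * h}, bijective Theta &
        forall g, Psi (Theta g) \o k =1 k \o Phi g].
Proof.
move=> fPhi fPsi kE kK k'K; have [ki kc ko ka kb] := kE.
have [k'i _ _ k'a _] := adapted_embedding_inv x0 kE kK k'K.
have [T TE] := choice ka; have [T' T'E] := choice k'a.
exists T; split => //.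
  move=> g h; apply: fPsi => y; rewrite -[y]k'K [LHS]TE /= !hactM.
  by rewrite [Psi (T h) _]TE [RHS]TE.
apply: (@Bijective _ _ T T').
  by move=> g; apply: fPhi => x; rewrite -[x]kK [LHS]T'E /= [Psi _ _]TE /= !kK.
by move=> g; apply: fPsi => y; rewrite -[y]k'K [LHS]TE /= [Phi _ _]T'E /= !k'K.
Qed.

End AdaptedEmbedding.

Lemma adapted_embedding_iter (G : groupType) (X : topologicalType)
    (Phi : homeo_action G X) (l : X -> X) n :
  adapted_embedding Phi Phi l -> adapted_embedding Phi Phi (iter n l).
Proof.
move=> lE; elim: n => [|n IH] /=.
  split=> [x y //|x|A oA|g|g _ _ _]; [exact: cvg_id|by rewrite image_id| |].
  - by exists g.
  - by exists g.
exact: (adapted_embedding_comp lE IH).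
Qed.

Lemma adapted_embedding_range (R : realType) (G K : groupType)
    (X : topologicalType) (Y : metricType R) (Phi : homeo_action G X)
    (Psi : homeo_action K Y) (k : X -> Y) (x0 : X) :
  compact [set: X] ->
  adapted_embedding Phi Psi k -> adapted Psi (range k).
Proof.
move=> cX [ki kc ko ka kb]; split.
- by exists (k x0); exists x0.
- split; first exact/ko/openT.
  apply: compact_closed; first exact: metric_hausdorff.
  apply: continuous_compact => //.
  exact: continuous_subspaceT.
- move=> g [_ [[_ [x _ <-] <-] [y _ /esym gxy]]].
  have [g1 g1E] := kb _ _ _ gxy; apply/seteqP; split.
    by move=> _ [_ [z _ <-] <-]; exists (Phi g1 z) => //; exact/esym/g1E.
  move=> _ [z _ <-]; exists (k (Phi g1^-1 z)); first by eexists.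
  by rewrite [LHS]g1E /= hactKV.
Qed.

(** * Restriction to the range of an adapted embedding *)

Section Restriction.
Variables (G : groupType) (X : topologicalType).
Variables (Phi : homeo_action G X) (U : set X).

Lemma open_set_val (A : set U) : open U -> open A -> open (set_val @` A).
Proof.
move=> oU [B oB <-].
suff -> : set_val @` (set_val @^-1` B : set U) = B `&` U by exact: openI.
apply/seteqP; split => [_ [x Bx <-]|x [Bx Ux]].
  by split => //; exact: set_valP.
by exists (SigSub (mem_set Ux)).
Qed.

Lemma continuous_set_val : continuous (set_val : U -> X).
Proof. exact: initial_continuous. Qed.

Lemma restr_groupP (f : restr_group Phi U) :
  exists2 g, stabilizer Phi U g &
    forall x : U, set_val (f x) = Phi g (set_val x).
Proof. by case: f => f /= /asboolP. Qed.

Lemma restr_group_of g : stabilizer Phi U g ->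
  exists f : restr_group Phi U,
    forall x : U, set_val (f x) = Phi g (set_val x).
Proof.
have lift h : stabilizer Phi U h ->
    exists2 f : U -> U, continuous f &
      forall x, set_val (f x) = Phi h (set_val x).
  move=> hU; have hUin (x : U) : Phi h (set_val x) \in U.
    apply: mem_set; suff : (Phi h @` U) (Phi h (set_val x)) by rewrite hU.
    by exists (set_val x) => //; exact: set_valP.
  exists (fun x => SigSub (hUin x)) => //.
  apply: continuous_comp_initial.
  change (continuous (Phi h \o set_val : U -> X)) => x.
  apply: continuous_comp; first exact: continuous_set_val.
  exact: hact_continuous.
move=> gU; have [f fc fE] := lift _ gU.
have [f' f'c f'E] := lift _ (stabilizerV gU).
have fh : `[< homeomorphism f >].
  apply/asboolP; exists f'; split => // x; apply: val_inj.
    by rewrite -!set_valE f'E fE hactK.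
  by rewrite -!set_valE fE f'E hactKV.
have fp : restr_pred Phi (Homeo fh) by apply/asboolP; exists g.
by exists (RestrGroup fp).
Qed.

Lemma restr_action_faithful : faithful (restr_action Phi U).
Proof. by move=> f f' ff'; apply/val_inj/homeo_eqP. Qed.

End Restriction.

(** Any adapted embedding is a conjugacy onto the restriction of the target
action to its range. *)
Lemma adapted_embedding_corestrict (G K : groupType) (X Y : topologicalType)
    (Phi : homeo_action G X) (Psi : homeo_action K Y) (k : X -> Y) :
  adapted_embedding Phi Psi k ->
  exists (k1 : X -> range k) (k1' : range k -> X),
    [/\ adapted_embedding Phi (restr_action Psi (range k)) k1,
        inverse_homeos k1 k1' & forall x, set_val (k1 x) = k x].
Proof.
move=> [ki kc ko ka kb].
pose k1 x : range k := SigSub (mem_set (imageT k x)).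
have k1E x : set_val (k1 x) = k x by [].
have k1surj (y : range k) : exists x, k1 x = y.
  by have [x _ xy] := set_valP y; exists x; apply: val_inj.
have k1i : injective k1 by move=> x y /(congr1 set_val) /ki.
have k1c : continuous k1 by exact: continuous_comp_initial.
have k1o A : open A -> open (k1 @` A).
  move=> oA; exists (k @` A); first exact: ko.
  apply/seteqP; split=> [y [x Ax xy]|_ [x Ax <-]]; last by exists x.
  by exists x => //; apply: val_inj.
have [k1' k1'E] := choice k1surj.
have k1K : cancel k1 k1' by move=> x; apply: k1i.
exists k1, k1'; split => //.
- split => //.
  + move=> g; have [g' g'E] := ka g.
    have /restr_group_of[f fE] : stabilizer Psi (range k) g'.
      apply/seteqP; split.
        by move=> _ [_ [z _ <-] <-]; exists (Phi g z) => //; exact/esym/g'E.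
      move=> _ [z _ <-]; exists (k (Phi g^-1 z)); first by eexists.
      by rewrite [LHS]g'E /= hactKV.
    by exists f => x; apply: val_inj; rewrite -set_valE [LHS]fE [LHS]g'E.
  + move=> f x y fxy; have [g' _ fE] := restr_groupP f.
    have /kb[g gE] : Psi g' (k x) = k y.
      exact: etrans (esym (fE (k1 x))) (congr1 set_val fxy).
    by exists g => z; apply: val_inj; rewrite -set_valE [LHS]fE; exact: gE.
- split => //; apply/continuousP => A oA.
  suff -> : k1' @^-1` A = k1 @` A by exact: k1o.
  apply/seteqP; split => [y /= Ay|_ [x Ax <-] /=]; last by rewrite k1K.
  by exists (k1' y).
Qed.

(** * Renormalizations as adapted self-embeddings *)

Section Renormalization.
Variables (R : realType) (G : groupType) (X : metricType R).
Variable Phi : homeo_action G X.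

(** Renormalizable actions are faithful because the group [H_U] to which [G] is
isomorphic consists of homeomorphisms.  Working with the map [l] from [X] to
itself avoids iterating a map into a subtype and a group isomorphism onto a
group of restrictions. *)
Lemma renormalizableE :
  renormalizable Phi <->
  [/\ cantor_action Phi, equicontinuous_action Phi, faithful Phi &
    exists l : X -> X, [/\ adapted_embedding Phi Phi l,
      range l <> [set: X] &
      exists x : X, \bigcap_(n in [set: nat]) range (iter n l) = [set x]]].
Proof.
split=> [[cP eP [U [aU UX [lam [lam' [T [lamI [TM Tb] TE lcap]]]]]]]|].
  have [lamK lam'K lamc lam'c] := lamI.
  have TEl g x : restr_action Phi U (T g) (lam x) = lam (Phi g x).
    by rewrite TE /= lam'K.
  split => //.
    move=> g h gh; apply: (bij_inj Tb); apply: restr_action_faithful => y.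
    by rewrite -[y]lam'K !TEl gh.
  have [_ [oU _] aUg] := aU.
  exists (set_val \o lam); split => //; first split.
  - by apply: inj_comp; [exact: val_inj|exact: can_inj lamK].
  - move=> x; apply: continuous_comp; first exact: lamc.
    exact: continuous_set_val.
  - move=> A oA; rewrite -image_comp; apply: open_set_val => //.
    suff -> : lam @` A = lam' @^-1` A by move/continuousP : lam'c; apply.
    apply/seteqP; split => [_ [x Ax <-] /=|y /= Ay]; first by rewrite lamK.
    by exists (lam' y).
  - move=> g; have [g' _ g'E] := restr_groupP (T g).
    by exists g' => x /=; rewrite -g'E; congr set_val; exact: TEl.
  - move=> g' x y /= gxy.
    have /restr_group_of[f fE] : stabilizer Phi U g'.
      apply: aUg; exists (set_val (lam y)); split; last exact: set_valP.
      by exists (set_val (lam x)) => //; exact: set_valP.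
    have [T' T'K TK] := Tb; exists (T' f) => z /=.
    by rewrite -TEl TK -fE.
  - move=> lX; apply: UX; rewrite -lX; apply/seteqP; split.
      move=> x Ux; pose y : U := SigSub (mem_set Ux).
      by exists (lam' y) => //=; rewrite lam'K.
    by move=> _ [x _ <-]; exact: set_valP.
move=> [cP eP fP [l [lE lX [x0 lcap]]]]; split => //.
have [_ [_ cptX _ _] _ _] := cP.
exists (range l); split => //;
  first exact: adapted_embedding_range x0 cptX lE.
have [lam [lam' [lamE lamI lamv]]] := adapted_embedding_corestrict lE.
have [lamK lam'K _ _] := lamI.
have [T [TM Tb TE]] := adapted_embedding_isom x0 fP
  (@restr_action_faithful _ _ Phi (range l)) lamE lamK lam'K.
exists lam, lam', T; split => //.
  by move=> g; apply/funext => x;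
    rewrite -compA [RHS](congr1 lam' (TE g x)) /= lamK.
by exists x0; have -> : set_val \o lam = l by exact/funext.
Qed.

End Renormalization.

Lemma finitely_generated_bij (G K : groupType) (T : G -> K) :
  {morph T : g h / g * h} -> bijective T ->
  finitely_generated G -> finitely_generated K.
Proof.
move=> TM [T' TK T'K] [s sG]; exists (map T s) => S [S1 SV] sS g.
have T1 : T 1 = 1 by apply: (@mulgI _ (T 1)); rewrite -TM !mulg1.
have TV h : T h^-1 = (T h)^-1.
  by apply: (@mulgI _ (T h)); rewrite -TM !mulgV T1.
suff : T' g \in [pred h | T h \in S] by rewrite inE T'K.
apply: sG => [|h hs]; last by rewrite inE; apply/sS/map_f.
by split=> [|h h']; rewrite !inE ?T1// TM TV; exact: SV.
Qed.

Lemma cantor_like_homeo (X Y : topologicalType) (k : X -> Y) (k' : Y -> X) :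
  inverse_homeos k k' -> cantor_like X -> cantor_like Y.
Proof.
move=> [kK k'K kc k'c] [pX cX hX zX].
have kset1 x : k' @^-1` [set x] = [set k x].
  by apply/seteqP; split => [y /= <-|y /= ->]; rewrite ?k'K ?kK.
have k'set1 y : k @^-1` [set y] = [set k' y].
  by apply/seteqP; split => [x /= <-|x /= ->]; rewrite ?k'K ?kK.
split.
- apply/perfectTP => y oy; move/perfectTP/(_ (k' y)) : pX; apply.
  by rewrite -k'set1; move/continuousP : kc; apply.
- have <- : k @` [set: X] = [set: Y].
    by apply/seteqP; split => // y _; exists (k' y).
  by apply: continuous_compact => //; exact: continuous_subspaceT.
- move: hX; rewrite !open_hausdorff => hX x y xy.
  have /hX[[A B] /= [xA yB] [oA oB AB]] : k' x != k' y.
    by apply: contra xy => /eqP/(can_inj k'K) ->.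
  exists (k' @^-1` A, k' @^-1` B) => /=; first by rewrite !inE in xA yB *.
  split; [by move/continuousP : k'c; apply..|].
  by rewrite -preimage_setI (eqP AB) preimage_set0.
- move=> x y xy.
  have /zX[A [[oA cA] Ax Ay]] : k' x != k' y.
    by apply: contra xy => /eqP/(can_inj k'K) ->.
  exists (k' @^-1` A); split => //; split.
    by move/continuousP : k'c; apply.
  by apply: closed_comp => // z _; exact: k'c.
Qed.

Lemma minimal_homeo (R : realType) (G K : groupType) (X Y : metricType R)
    (Phi : homeo_action G X) (Psi : homeo_action K Y) (k : X -> Y)
    (k' : Y -> X) :
  inverse_homeos k k' -> adapted_embedding Phi Psi k ->
  minimal Phi -> minimal Psi.
Proof.
move=> [kK k'K kc k'c] [_ _ _ ka _] mP y A [z Az] oA.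
have kA0 : k @^-1` A !=set0 by exists (k' z); rewrite /= k'K.
have kAo : open (k @^-1` A) by move/continuousP : kc; apply.
have [x [Akx [g _ gx]]] := mP (k' y) _ kA0 kAo.
have [g' g'E] := ka g; exists (k x); split => //; exists g' => //.
by rewrite -gx -{1}[y]k'K [LHS]g'E.
Qed.

Lemma restr_action_equicontinuous (R : realType) (G : groupType)
    (X : metricType R) (Phi : homeo_action G X) (U : set X) :
  equicontinuous_action Phi -> equicontinuous_action (restr_action Phi U).
Proof.
move=> eP e /eP[d d0 dP]; exists d => // f x y xy.
have [g _ gE] := restr_groupP f.
have fE z : set_val (restr_action Phi U f z) = Phi g (set_val z) := gE z.
by rewrite mdist_set_val !fE; exact: dP.
Qed.

(** The self-embedding [l] is transported to [k \o l \o k']. *)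
Lemma renormalizable_conj (R : realType) (G K : groupType)
    (X Y : metricType R) (Phi : homeo_action G X) (Psi : homeo_action K Y)
    (k : X -> Y) (k' : Y -> X) :
  adapted_embedding Phi Psi k -> inverse_homeos k k' ->
  faithful Psi -> equicontinuous_action Psi ->
  renormalizable Phi -> renormalizable Psi.
Proof.
move=> kE kI fPsi ePsi /renormalizableE[[X0 clX fgG mPhi] _ fPhi].
move=> [l [lE lX [x0 lcap]]]; have [kK k'K kc k'c] := kI.
have k'E := adapted_embedding_inv x0 kE kK k'K.
have [T [TM Tb _]] := adapted_embedding_isom x0 fPhi fPsi kE kK k'K.
apply/renormalizableE; split => //.
  split; first by exists (k x0).
  - exact: cantor_like_homeo kI clX.
  - exact: finitely_generated_bij TM Tb fgG.
  - exact: minimal_homeo kI kE mPhi.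
have iterE n y : iter n (k \o l \o k') y = k (iter n l (k' y)).
  by elim: n => [|n IH] /=; rewrite ?k'K// IH /= kK.
exists (k \o l \o k'); split.
- exact: adapted_embedding_comp (adapted_embedding_comp kE lE) k'E.
- move=> kl; apply: lX; apply/seteqP; split => // x _.
  have [y _ /= /(can_inj kK) <-] : range (k \o l \o k') (k x) by rewrite kl.
  by exists (k' y).
- exists (k x0); apply/seteqP; split.
    move=> y yl; rewrite -[y]k'K; congr k.
    suff : (\bigcap_(n in [set: nat]) range (iter n l)) (k' y) by rewrite lcap.
    by move=> n _; have [z _ <-] := yl n I; rewrite iterE kK; exists (k' z).
  move=> _ -> n _.
  have [x _ xE] : range (iter n l) x0.
    by have : [set x0] x0 by []; rewrite -lcap; apply.
  by exists (k x) => //; rewrite iterE kK xE.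
Qed.

(** * Shrinking ranges and topological freeness *)

Definition topologically_free (G : groupType) (X : topologicalType)
    (Phi : homeo_action G X) :=
  forall g g' V, open V -> V !=set0 ->
    (forall x, V x -> Phi g x = Phi g' x) -> g = g'.

(** A decreasing sequence of closed sets that meet in one point of a compact
space converges to it: each other point has a neighbourhood that the
sequence leaves, and finitely many of these and [W] cover the space. *)
Lemma compact_nested_bigcap (X : topologicalType) (F : nat -> set X) (x0 : X)
    (W : set X) :
  compact [set: X] -> (forall n, closed (F n)) ->
  (forall m n, (m <= n)%N -> F n `<=` F m) ->
  \bigcap_(n in [set: nat]) F n = [set x0] -> nbhs x0 W ->
  exists n, F n `<=` W.
Proof.
move=> /compact_near_coveringP cX cF dF capF W0.
suff : \forall n \near \oo, forall x, [set: X] x -> (F n x -> W x).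
  by case=> N _ NP; exists N => x; apply: (NP N (leqnn N)).
apply: (cX nat \oo (fun n x => F n x -> W x)) => x _.
have [->|xx0] := pselect (x = x0).
  by exists (W, setT) => [|[y n] /= [Wy _] _ //]; split => //=; exact: filterT.
have [m Fmx] : exists m, ~ F m x.
  apply: contra_notP xx0 => /forallNP xF.
  suff : (\bigcap_(n in [set: nat]) F n) x by rewrite capF.
  by move=> n _; exact: (contrapT (xF n)).
exists (~` F m, [set n | (m <= n)%N]) => [|[y n] /= [Fmy mn] /(dF _ _ mn) //].
split => /=; last by exists m.
by apply: open_nbhs_nbhs; split => //; exact/closed_openC/cF.
Qed.

Section Contraction.
Variables (R : realType) (G : groupType) (X : metricType R).
Variables (Phi : homeo_action G X) (l : X -> X) (x0 : X).
Hypothesis cptX : compact [set: X].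
Hypothesis lE : adapted_embedding Phi Phi l.
Hypothesis lcap : \bigcap_(n in [set: nat]) range (iter n l) = [set x0].

Lemma range_iter_small (W : set X) :
  nbhs x0 W -> exists n, range (iter n l) `<=` W.
Proof.
move=> W0; apply: compact_nested_bigcap lcap W0 => // [n|m n mn _ [x _ <-]].
  by have [_ [_ ?] _] := adapted_embedding_range x0 cptX
    (adapted_embedding_iter n lE).
by rewrite -(subnKC mn) iterD; eexists.
Qed.

(** The copy [g1] of [gamma] under [iter n l] is the identity on the image of
[V], hence on the whole small set [range (iter n l)], which is a copy of [X]. *)
Lemma locally_quasi_analytic_topologically_free :
  faithful Phi -> locally_quasi_analytic Phi -> topologically_free Phi.
Proof.
move=> fPhi [e e0 lqa] g g' V oV [v Vv] gg'.
have e30 : (0 < e / 3)%R by rewrite divr_gt0.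
have [n lne] := range_iter_small (nbhsx_ballx x0 _ e30).
have [li lc lo la _] := adapted_embedding_iter n lE.
have diamU : (diam (range (iter n l)) < e%:E)%E.
  apply: (@le_lt_trans _ _ (e / 3 + e / 3)%:E); last first.
    by rewrite lte_fin; lra.
  apply/ereal_supP => _ [[p q] [/lne xp /lne xq] <-]; rewrite lee_fin /=.
  move: xp xq; rewrite !ballEmdist /= => xp xq.
  by rewrite (le_trans (metric_triangle p x0 q))// metric_sym lerD// ltW.
pose gamma := g'^-1 * g.
have gammaV x : V x -> Phi gamma x = x.
  by move=> /gg' xx; rewrite hactM xx hactK.
have [g1 g1E] := la gamma.
have g1V y : (iter n l @` V) y -> Phi g1 y = y.
  by move=> [x Vx <-]; rewrite [LHS]g1E /= gammaV.
have g1id : {in range (iter n l), Phi g1 =1 id}.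
  apply: (lqa _ (iter n l @` V)) => //; [exact/lo/openT| |exact: lo| | | |].
  - by exists (iter n l x0), x0.
  - by exists (iter n l v), v.
  - by move=> _ [x _ <-]; exists x.
  - apply/seteqP; split => [_ [y Vy <-]|y Vy]; first by rewrite g1V.
    by exists y => //; exact: g1V.
  - by move=> y /set_mem; exact: g1V.
apply: fPhi => x; have gx : Phi gamma x = x.
  by apply: li; rewrite -[LHS]g1E; apply/g1id/mem_set; exists x.
by rewrite -[in RHS]gx -hactM mulgA mulgV mul1g.
Qed.

End Contraction.

(** * Orbit equivalences onto topologically free actions *)

(** The Lebesgue number of a covering on which [f] is locally constant. *)
Lemma locally_constant_uniform (R : realType) (X : metricType R)
    (T : choiceType) (f : X -> discrete_topology T) :
  compact [set: X] -> continuous f ->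
  exists2 d : R, (0 < d)%R &
    forall x y, (mdist x y < d)%R -> f x = f y.
Proof.
move=> /compact_near_coveringP cX fc.
have : \forall d \near (0 : R)^'+, forall x, [set: X] x ->
    (forall y, (mdist x y < d)%R -> f x = f y).
  apply: (cX R _ (fun d x => forall y, (mdist x y < d)%R -> f x = f y)) => x _.
  have /nbhs_ballP[e /= e0 eP] : nbhs x [set y | f y = f x].
    by apply: (fc x [set z | z = f x]); exact/principal_filterP.
  have e20 : (0 < e / 2)%R by rewrite divr_gt0.
  exists (ball x (e / 2), [set d | d < e / 2]%R); first split => /=.
  - exact: nbhsx_ballx.
  - exact: nbhs_right_lt.
  move=> [y d] /= [xy de] z yz.
  have -> : f y = f x.
    by apply: eP; apply: le_ball xy; rewrite ler_pdivrMr// ler_peMr ?ltW//; lra.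
  apply/esym/eP; rewrite ballEmdist /=; move: xy; rewrite ballEmdist /= => xy.
  by rewrite (le_lt_trans (metric_triangle x y z))//; lra.
move=> nd; have : \forall d \near (0 : R)^'+, (0 < d)%R by exact: nbhs_right_gt.
by move=> /(filterI nd)/filter_ex[d [dP d0]]; exists d => // x; exact: dP.
Qed.

Lemma locally_constant_uniform_seq (R : realType) (X : metricType R)
    (I T : choiceType) (f : I -> X -> discrete_topology T) (s : seq I) :
  compact [set: X] -> (forall i, continuous (f i)) ->
  exists2 d : R, (0 < d)%R &
    forall i x y, i \in s -> (mdist x y < d)%R -> f i x = f i y.
Proof.
move=> cX fc; elim: s => [|i s [d d0 dP]]; first by exists 1%R.
have [d' d'0 d'P] := locally_constant_uniform cX (fc i).
exists (Num.min d d'); first by rewrite lt_min d0.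
move=> j x y; rewrite inE lt_min => /orP[/eqP ->|js] /andP[xyd xyd'].
  exact: d'P.
exact: dP.
Qed.

Section OrbitEquivalence.
Variables (R : realType) (G G' : groupType) (X X' : metricType R).
Variables (Phi : homeo_action G X) (Phi' : homeo_action G' X').

(** The cocycle identity says that the elements [a] for which [beta (a, -)]
agrees at the two points [Phi' b y] and [Phi' b y0] for every [b] form a
subgroup.  For [y] close to [y0] it contains the generators, by uniform local
constancy and equicontinuity, so [beta (g', y) = beta (g', y0)] for all [g'].
The last conclusion uses [alpha] only to produce, at the single point [h' y0],
an element [g'] with the germ of [g]; then [beta (g', y0) = g] by freeness. *)
Lemma orbit_equivalence_local_conjugacy (h : X -> X') (h' : X' -> X)
    (alpha : G -> X -> G')
    (beta : discrete_topology G' * X' -> discrete_topology G) (y0 : X') :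
  topologically_free Phi ->
  compact [set: X'] -> finitely_generated G' -> equicontinuous_action Phi' ->
  inverse_homeos h h' -> continuous beta ->
  (forall (x : X) (g : G), exists U : set X, [/\ open U, U x &
     {in U, Phi' (alpha g x) \o h =1 h \o Phi g}]) ->
  (forall (y : X') (g' : G'), exists V : set X', [/\ open V, V y &
     {in V, Phi (beta (g', y)) \o h' =1 h' \o Phi' g'}]) ->
  exists P : set X', [/\ nbhs y0 P,
    forall g', exists g, forall y, P y -> h' (Phi' g' y) = Phi g (h' y) &
    forall g, exists g', forall y, P y -> h' (Phi' g' y) = Phi g (h' y)].
Proof.
move=> free cptX' [s sG'] eP' [hK h'K hc h'c] bc al be.
have germ g' y g V : open V -> V y ->
    (forall z, V z -> h' (Phi' g' z) = Phi g (h' z)) -> beta (g', y) = g.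
  move=> oV Vy gV; have [W [oW Wy bW]] := be y g'.
  apply: (free _ _ (h @^-1` (V `&` W))).
  - by move/continuousP : hc; apply; exact: openI.
  - by exists (h' y); rewrite /= h'K.
  - move=> x [/= Vhx Whx]; rewrite -{2}[x]hK -gV//.
    by rewrite -[RHS]bW ?inE//= hK.
have betaM a b y : beta (a * b, y) = beta (a, Phi' b y) * beta (b, y).
  have [V [oV Vy bV]] := be y b; have [W [oW Wy aW]] := be (Phi' b y) a.
  apply: (@germ _ _ _ (V `&` Phi' b @^-1` W)) => //.
    apply: openI => //.
    by have /continuousP := @hact_continuous _ _ Phi' b; apply.
  move=> z [Vz /= Wz]; rewrite !hactM.
  by rewrite [Phi (beta (b, y)) _]bV ?inE//= [RHS]aW ?inE.
have bca a : continuous (fun y => beta (a, y)).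
  move=> y; apply: (@continuous_comp _ _ _ (fun y => (a, y)) beta);
    last exact: bc.
  exact: (cvg_pair (F:=nbhs y) (cvg_cst _) cvg_id).
have [e e0 eP] := @locally_constant_uniform_seq R X' G' G
  (fun a y => beta (a, y)) s cptX' bca.
have [d d0 dP] := eP' e e0.
pose P := [set y | (mdist y0 y < d)%R].
have betaP g' y : P y -> beta (g', y) = beta (g', y0).
  move=> Py; pose S : {pred G'} :=
    fun a => `[< forall b, beta (a, Phi' b y) = beta (a, Phi' b y0) >].
  suff /asboolP /(_ 1) : g' \in S by rewrite !hact1.
  have SE a :
      reflect (forall b, beta (a, Phi' b y) = beta (a, Phi' b y0)) (a \in S).
    exact: asboolP.
  apply: sG'; last first.
    by move=> a sa; apply/SE => b; apply/esym/eP => //; exact: dP.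
  have beta1 z : beta (1, z) = 1.
    by apply: (@mulgI _ (beta (1, z))); rewrite -{1}[z](hact1 Phi')
      -betaM !mulg1.
  split; first by apply/SE => b; rewrite !beta1.
  move=> a c /SE aP /SE bP; apply/SE => b.
  have betaV z : beta (c^-1, z) = (beta (c, Phi' c^-1 z))^-1.
    by apply: (@mulgI _ (beta (c, Phi' c^-1 z))); rewrite -betaM !mulgV beta1.
  by rewrite !betaM !betaV -!hactM aP bP.
exists P; split.
- by rewrite -[P]ballEmdist; exact: nbhsx_ballx.
- move=> g'; exists (beta (g', y0)) => y Py.
  by have [V [oV Vy bV]] := be y g'; rewrite -(betaP g' y)// [RHS]bV ?inE.
- move=> g; have [U [oU Uy aU]] := al (h' y0) g.
  pose g' := alpha g (h' y0); exists g' => y Py.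
  have bg : beta (g', y0) = g.
    apply: (@germ _ _ _ (h' @^-1` U)) => //.
      by move/continuousP : h'c; apply.
    by move=> z Uz; rewrite -[z in LHS]h'K [Phi' _ _]aU ?inE//= hK.
  by have [V [oV Vy bV]] := be y g'; rewrite -bg -(betaP g' y)// [RHS]bV ?inE.
Qed.

End OrbitEquivalence.

Theorem theorem1p7 (R : realType) (X X' : metricType R) (G G' : groupType)
    (Phi : homeo_action G X) (Phi' : homeo_action G' X') :
  cantor_action Phi -> equicontinuous_action Phi ->
  cantor_action Phi' -> equicontinuous_action Phi' ->
  continuously_orbit_equivalent Phi Phi' ->
  renormalizable Phi -> locally_quasi_analytic Phi ->
  virtually_renormalizable Phi'.
Proof.
move=> [_ [_ cX _ _] _ _] _ cP' eP' [h [h' [alpha [beta [hI _ [_ bc] al be]]]]].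
move=> rPhi lqa.
have /renormalizableE[_ _ fPhi [l [lE _ [x0 lcap]]]] := rPhi.
have [_ [_ cX' _ _] fgG' _] := cP'.
have free := locally_quasi_analytic_topologically_free cX lE lcap fPhi lqa.
have [P [Py0 P1 P2]] := orbit_equivalence_local_conjugacy (h x0) free cX' fgG'
  eP' hI bc (alpha := fun g x => alpha (g, x)) al be.
have [hK h'K hc h'c] := hI.
have [n lP] := range_iter_small cX lE lcap (hc x0 _ Py0).
have [li lc lo la lb] := adapted_embedding_iter n lE.
have inP x : P (h (iter n l x)) by apply: lP; exists x.
(* On P, the identity h' (Phi' g' y) = Phi g (h' y) turns each clause for
   iter n l into the same clause for its composite with h. *)
have kE : adapted_embedding Phi Phi' (h \o iter n l).
  split.
  - by apply: inj_comp => //; exact: can_inj hK.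
  - by move=> x; apply: continuous_comp; [exact: lc|exact: hc].
  - move=> A oA; rewrite -image_comp.
    suff -> : h @` (iter n l @` A) = h' @^-1` (iter n l @` A).
      by move/continuousP : h'c; apply; exact: lo.
    apply/seteqP; split => [_ [x Ax <-] /=|y /= Ay]; first by rewrite hK.
    by exists (h' y).
  - move=> g; have [g1 g1E] := la g; have [g' g'E] := P2 g1.
    by exists g' => x /=; rewrite -[LHS]h'K g'E// hK; congr h; exact: g1E.
  - move=> g' x y /= gxy; have [g1 g1E] := P1 g'.
    have /lb[g gE] : Phi g1 (iter n l x) = iter n l y.
      by rewrite -[iter n l x]hK -g1E// gxy hK.
    by exists g => z /=; rewrite -[LHS]h'K g1E// hK; congr h; exact: gE.
split => //; exists (range (h \o iter n l)).
  exact: adapted_embedding_range x0 cX kE.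
have [k1 [k1' [k1E k1I _]]] := adapted_embedding_corestrict kE.
apply: (renormalizable_conj k1E k1I) => //.
  exact: restr_action_faithful.
exact: restr_action_equicontinuous.
Qed.
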